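(* Let $(A,d)$ be a compact positive definite metric space. A measure $\mu \in M(A)$ achieves the supremum $$|A| = \sup \left\{ \frac{\nu(A)^2}{Z_A(\nu,\nu)} : \nu \in M(A),\ Z_A(\nu,\nu) \neq 0 \right\}$$ (i.e. $Z_A(\mu,\mu)\neq 0$ and $\mu(A)^2/Z_A(\mu,\mu) = |A|$) if and only if $\mu$ is a nonzero scalar multiple of a weight measure for $A$. Moreover, if $\mu$ is a weight measure for $A$ then $|A| = \mu(A)$.
   Context: Metric spaces are nonempty. For a finite metric space $(B,d)$, its similarity matrix is $\zeta_B \in \mathbb{R}^{B\times B}$, $\zeta_B(x,y)=e^{-d(x,y)}$; a metric space $A$ is positive definite if $\zeta_B$ is a positive definite matrix for every nonempty finite subset $B \subseteq A$ (with the induced metric). $M(A)$ denotes the space of finite signed Borel measures on $A$. For compact $A$, $Z_A$ is the bilinear form on $M(A)$ given by $Z_A(\mu,\nu) = \int_A\int_A e^{-d(x,y)}\,d\mu(x)\,d\nu(y)$. The magnitude of a compact positive definite metric space $A$ is $|A| = \sup\{\mu(A)^2/Z_A(\mu,\mu) : \mu\in M(A),\ Z_A(\mu,\mu)\neq 0\}$. A weight measure for $A$ is a measure $\mu\in M(A)$ such that $\int_A e^{-d(x,y)}\,d\mu(y) = 1$ for every $x\in A$. *)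

(* Defs.v *)
From HB Require Import structures.
From mathcomp Require Import all_boot all_order all_algebra finmap.
From mathcomp Require Import all_classical all_reals all_analysis.

Set Implicit Arguments.
Unset Strict Implicit.
Unset Printing Implicit Defensive.

Import Order.TTheory GRing.Theory Num.Theory.

Local Open Scope classical_set_scope.
Local Open Scope ring_scope.

(* Nonempty metric spaces, with a chosen point: a measurableType is pointed. *)
#[short(type="pmetricType")]
HB.structure Definition PointedMetric (K : numDomainType) :=
  {M of Metric K M & Pointed M}.

Definition posdefmx (R : realType) (n : nat) (M : 'M[R]_n) : Prop :=
  M^T = M /\ forall v : 'cV[R]_n, v != 0 -> 0 < (v^T *m M *m v) 0 0.

(* Rows and columns are indexed by the points of B through enum_val. *)
Definition similarity_matrix (R : realType) (A : metricType R) (B : {fset A})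
    : 'M[R]_#|{: B}| :=
  \matrix_(i, j) expR (- mdist (val (enum_val i)) (val (enum_val j))).

Definition positive_definite (R : realType) (A : metricType R) : Prop :=
  forall B : {fset A}, B != fset0 -> posdefmx (similarity_matrix B).

Notation borel A := (g_sigma_algebraType (@open A)).

(* M(A): finite signed Borel measures. Charges are finite on measurable sets, but their values on
   nonmeasurable sets are unconstrained, so two of them are the same signed
   measure when they agree on measurable sets. *)
Definition signed_measure (R : realType) (A : pmetricType R) : Type :=
  {charge set (borel A) -> \bar R}.

Section charge_integral.
Context d (T : measurableType d) (R : realType).
Variable nu : {charge set T -> \bar R}.

Definition hahn_pos : set T := sval (cid (Hahn_decomposition nu)).

Definition hahn_neg : set T := sval (cid (svalP (cid (Hahn_decomposition nu)))).

Lemma hahn_posneg : hahn_decomposition nu hahn_pos hahn_neg.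
Proof. exact: svalP (cid (svalP (cid (Hahn_decomposition nu)))). Qed.

(* By Hahn_decomposition_uniq, the Jordan decomposition nu = nu^+ - nu^- does
   not depend on the chosen Hahn decomposition on measurable sets. Meaningful
   when f is integrable for both parts, e.g. bounded and measurable. *)
Definition charge_integral (f : T -> R) : R :=
  Rintegral (jordan_pos hahn_posneg) [set: T] f -
  Rintegral (jordan_neg hahn_posneg) [set: T] f.

Definition total_mass : R := fine (nu [set: T]).

End charge_integral.

Section magnitude.
Context (R : realType) (A : pmetricType R).

Definition Zform (mu nu : signed_measure A) : R :=
  charge_integral nu (fun y : borel A =>
    charge_integral mu (fun x : borel A => expR (- mdist (x : A) (y : A)))).

Definition weight_measure (mu : signed_measure A) : Prop :=
  forall x : A,
    charge_integral mu (fun y : borel A => expR (- mdist x (y : A))) = 1.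

(* Extended-real valued: the supremum may be infinite. *)
Definition magnitude : \bar R :=
  ereal_sup [set (total_mass nu ^+ 2 / Zform nu nu)%:E
            | nu in [set nu : signed_measure A | Zform nu nu != 0]].

Definition achieves_magnitude (mu : signed_measure A) : Prop :=
  Zform mu mu != 0 /\ (total_mass mu ^+ 2 / Zform mu mu)%:E = magnitude.

End magnitude.

Arguments magnitude {R} A.

(* Main.v *)
Require Import Defs.
From mathcomp Require Import all_boot all_order all_algebra finmap.
From mathcomp Require Import all_classical all_reals all_analysis.
From mathcomp Require Import measurable_realfun ring lra.

(** Z_A is a symmetric positive semidefinite bilinear form on M(A).  A weight
    measure w represents the functional nu |-> nu(A), in the sense that
    Z_A(w, nu) = nu(A), so Cauchy-Schwarz gives
      nu(A)^2 = Z_A(w, nu)^2 <= Z_A(w, w) Z_A(nu, nu) = w(A) Z_A(nu, nu).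
    Hence |A| <= w(A), and w attains the bound provided w(A) != 0; that holds
    because w(A) = 0 would force every measure, and in particular a point mass,
    to have total mass 0 ([magnitude_weight]).

    Conversely let mu attain |A|.  Then |A| is a real number r >= 1 and, for
    every point x, the function t |-> r Z(t) - m(t)^2, where Z(t) and m(t) are
    the energy and the total mass of mu + t delta_x, is nonnegative for t near 0
    and vanishes at t = 0.  Its derivative there is 0, that is,
    r Z_A(mu, delta_x) = mu(A).  The left-hand side is r times the potential of
    mu at x, so (r / mu(A)) mu is a weight measure ([first_variation],
    [achieves_scaled_weight]).

    The bilinearity, symmetry and positivity of Z_A all come from one
    approximation.  A compact A is cut into finitely many small Borel cells with
    one tag in each; for a Lipschitz f the integral of f against a signed measure
    differs from the Riemann sum over the cells by at most the mesh times the
    Lipschitz constant times the total variation ([charge_integral_riemann]).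
    These sums involve only the values of the measure on Borel sets, and are
    linear in it, so limits give linearity of the integral in the measure without
    comparing Jordan decompositions.  The kernel exp(-d) and the potentials of
    measures are Lipschitz, so Z_A is a limit of finite double sums over the tags
    ([cvg_Zsum]).  Those are visibly symmetric, and nonnegative on the diagonal
    because the similarity matrix of the finite set of tags is positive
    definite; so symmetry follows without a Fubini theorem. *)

Set Implicit Arguments.
Unset Strict Implicit.
Unset Printing Implicit Defensive.

Import Order.TTheory GRing.Theory Num.Theory.
Import numFieldNormedType.Exports.

Local Open Scope classical_set_scope.
Local Open Scope ring_scope.

(** * Riemann sums over a finite measurable partition *)

Lemma bigsetU_ord_cover (T : Type) n (C : 'I_n -> set T) :
  (forall x, exists i, C i x) -> \big[setU/set0]_(i < n) C i = setT.
Proof.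
move=> cov; apply/seteqP; split=> // x _; have [i Cix] := cov x.
by rewrite -bigcup_seq; exists i => //=; rewrite mem_index_enum.
Qed.

Section measure_riemann.
Context d (T : measurableType d) (R : realType).
Context n (C : 'I_n -> set T).
Hypothesis mC : forall i, measurable (C i).
Hypothesis tC : trivIset setT C.
Hypothesis covC : forall x, exists i, C i x.

Lemma finite_measure_partition (m : {finite_measure set T -> \bar R}) :
  \sum_(i < n) fine (m (C i)) = fine (m setT).
Proof.
rewrite -(bigsetU_ord_cover covC) measure_bigsetU_ord//.
rewrite -sum_fine// => i _; exact: fin_num_measure.
Qed.

Lemma Rintegral_partition (m : {finite_measure set T -> \bar R}) (f : T -> R) :
  m.-integrable setT (EFin \o f) ->
  Rintegral m setT f = \sum_(i < n) Rintegral m (C i) f.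
Proof.
move=> intf; rewrite /Rintegral -(bigsetU_ord_cover covC).
rewrite integral_bigsetU_EFin//; last 3 first.
- exact: index_enum_uniq.
- exact: sub_trivIset tC.
- apply: (@measurable_funS _ _ _ _ setT) => //.
  exact: (measurable_int m).
rewrite -sum_fine// => i _.
apply: integrable_fin_num => //.
exact: integrableS intf.
Qed.

(** On each cell f is within e of the constant a i, and the errors e * m(C i)
    add up to e * m(T). *)
Lemma Rintegral_riemann (m : {finite_measure set T -> \bar R}) (f : T -> R)
    (a : 'I_n -> R) (e : R) :
  m.-integrable setT (EFin \o f) ->
  (forall i x, C i x -> `|f x - a i| <= e) ->
  `|Rintegral m setT f - \sum_(i < n) fine (m (C i)) * a i|
    <= e * fine (m setT).
Proof.
move=> intf fa; rewrite Rintegral_partition// -sumrB.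
apply: le_trans (ler_norm_sum _ _ _) _.
rewrite -finite_measure_partition mulr_sumr; apply: ler_sum => i _.
have intc (c : R) : m.-integrable (C i) (EFin \o cst c).
  exact: finite_measure_integrable_cst.
have intfi : m.-integrable (C i) (EFin \o f) by exact: integrableS intf.
have intB : m.-integrable (C i) (EFin \o (fun x => f x - a i)).
  exact: (@integrableB _ _ _ m (C i) (mC i) _ _ intfi (intc (a i))).
rewrite mulrC -Rintegral_cst// -RintegralB//; last exact: intc.
rewrite -Rintegral_cst//; apply: le_trans (le_normr_Rintegral _ _) _ => //.
apply: le_Rintegral => //; [exact: integrable_norm|exact: intc|].
exact: fa.
Qed.

Section charge.
Variable nu : {charge set T -> \bar R}.

(** The total variation |nu|(T), read off the Jordan decomposition by which
    [charge_integral] is defined. *)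
Definition variation_mass : R :=
  fine (jordan_pos (hahn_posneg nu) setT) +
  fine (jordan_neg (hahn_posneg nu) setT).

Lemma variation_mass_ge0 : 0 <= variation_mass.
Proof. by rewrite addr_ge0// fine_ge0. Qed.

Lemma fine_jordan (E : set T) : measurable E ->
  fine (nu E) = fine (jordan_pos (hahn_posneg nu) E) -
                fine (jordan_neg (hahn_posneg nu) E).
Proof.
move=> mE; rewrite (jordan_decomp (hahn_posneg nu) mE).
rewrite -[LHS]/(fine (jordan_pos (hahn_posneg nu) E
                      + (-1)%:E * jordan_neg (hahn_posneg nu) E)%E).
by rewrite EFinN mulN1e fineB// fin_num_measure.
Qed.

(** The estimate for measures, applied to both Jordan parts; their differences
    on the cells recombine into the values of nu, so the Riemann sum no longer
    mentions the decomposition. *)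
Lemma charge_integral_riemann (f : T -> R) (a : 'I_n -> R) (e : R) :
  measurable_fun setT f -> [bounded f x | x in setT] ->
  (forall i x, C i x -> `|f x - a i| <= e) ->
  `|charge_integral nu f - \sum_(i < n) fine (nu (C i)) * a i|
    <= e * variation_mass.
Proof.
move=> mf bf fa.
have intf (m : {finite_measure set T -> \bar R}) :
    m.-integrable setT (EFin \o f).
  by apply: measurable_bounded_integrable => //; rewrite ltey_eq fin_num_measure.
under eq_bigr do rewrite fine_jordan// mulrBl.
rewrite sumrB /charge_integral mulrDr.
rewrite opprB addrACA addrC (addrC (- _)).
set m1 := jordan_pos _; set m2 := jordan_neg _.
have := Rintegral_riemann (intf m1) fa.
have := Rintegral_riemann (intf m2) fa.
rewrite !ler_norml; lra.
Qed.

End charge.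
End measure_riemann.

(** * Small tagged Borel partitions of a compact metric space *)

Section borel_partition.
Context (R : realType) (A : pmetricType R).

Lemma measurable_open (U : set (borel A)) : open (U : set A) -> measurable U.
Proof. by move=> oU; exact: sub_sigma_algebra. Qed.

(** The cells are indexed like the rows of the similarity matrix of the set of
    tags, so that Riemann double sums for the kernel are values of the quadratic
    form of that matrix. *)
Record tagged_partition (e : R) := TaggedPartition {
  tags : {fset A};
  cell : 'I_#|{: tags}| -> set (borel A);
  measurable_cell : forall i, measurable (cell i);
  trivIset_cell : trivIset setT cell;
  cover_cell : forall x, exists i, cell i x;
  cell_small : forall i x, cell i x -> mdist (x : A) (val (enum_val i)) <= e }.

Definition tag e (p : tagged_partition e) (i : 'I_#|{: tags p}|) : A :=
  val (enum_val i).

(** Take a finite subcover by interiors of e-balls and remove from each the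
    union of the earlier ones. *)
Lemma compact_tagged_partition (e : R) : compact [set: A] -> 0 < e ->
  exists _ : tagged_partition e, True.
Proof.
rewrite compact_cover => cA e0.
have [||B _ cov] := cA A setT (fun x => (ball x e)^°).
- by move=> x _; exact: open_interior.
- by move=> x _; exists x => //; exact: nbhsx_ballx.
pose t (i : 'I_#|{: B}|) : A := val (enum_val i).
pose b (i : 'I_#|{: B}|) : set (borel A) := (ball (t i) e)^°.
pose C i := b i `\` \bigcup_(j in [set j : 'I_#|{: B}| | (j < i)%N]) b j.
have mb i : measurable (b i) by apply: measurable_open; exact: open_interior.
unshelve eexists; last by [].
apply: (@TaggedPartition e B C) => [i|i j _ _ [x [[bi ni] [bj nj]]]|x|i x [bi _]].
- apply: measurableD => //; apply: fin_bigcup_measurable => //.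
- apply/val_inj/eqP; rewrite eqn_leq.
  apply/andP; split; rewrite leqNgt; apply/negP => ij.
  + by apply: ni; exists j.
  + by apply: nj; exists i.
- have [y /= yB bx] := cov x I.
  have bx0 : x \in b (enum_rank [` yB]%fset) by rewrite inE /b /t enum_rankK.
  (* the cell of x is that of the first ball containing x *)
  case: (@arg_minnP _ _ (fun i => x \in b i) val bx0) => i /set_mem bi mini.
  exists i; split=> // -[j /= ji bj].
  by have := mini j (mem_set bj); rewrite leqNgt ji.
- by have := interior_subset bi; rewrite ballEmdist/= metric_sym => /ltW.
Qed.

End borel_partition.

Arguments cell {R A e} t i.
Arguments tags {R A e} t.
Arguments tag {R A e} p i.

Section lipschitz.
Context (R : realType) (A : pmetricType R).

Definition lipschitz_with (L : R) (f : borel A -> R) :=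
  forall x y, `|f x - f y| <= L * mdist (x : A) (y : A).

Variables (L : R) (f : borel A -> R).
Hypotheses (compactA : compact [set: A]) (L0 : 0 <= L) (lipf : lipschitz_with L f).

Lemma lipschitz_measurable : measurable_fun setT f.
Proof.
have cf : continuous (f : A -> R).
  move=> x; apply/cvgrPdist_le => e e0.
  have d0 : 0 < e / (L + 1) by rewrite divr_gt0// ltr_wpDl.
  apply/nbhs_ballP; exists (e / (L + 1)) => //= y; rewrite ballEmdist/= => xy.
  apply: le_trans (lipf x y) _.
  apply: (@le_trans _ _ ((L + 1) * mdist (x : A) (y : A))).
    by rewrite ler_wpM2r ?mdist_ge0// lerDl.
  by rewrite mulrC -ler_pdivlMr ?ltr_wpDl// ltW.
apply: (measurability _ (RGenOpens.measurableE R)) => _ [_ [a [b ->] <-]].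
rewrite setTI; apply: measurable_open.
by move/continuousP: cf; apply; exact: interval_open.
Qed.

(** With cells of radius 1, f is within L of one of finitely many values. *)
Lemma lipschitz_bounded : [bounded f x | x in setT].
Proof.
have [p _] := compact_tagged_partition compactA ltr01.
exists (L + \sum_i `|f (tag p i)|); split; first exact: num_real.
move=> M /ltW ltM x _ /=.
apply: le_trans ltM; have [i Cix] := cover_cell p x.
rewrite (bigD1 i)//= addrA -[f x](subrK (f (tag p i))).
apply: le_trans (ler_normD _ _) _.
rewrite -[leLHS]addr0 lerD ?sumr_ge0// lerD2r.
apply: le_trans (lipf _ _) _; rewrite -[leRHS]mulr1 ler_wpM2l//.
exact: cell_small Cix.
Qed.

End lipschitz.

(** * Integrals against signed measures as limits of Riemann sums *)

Section charge_integral_bounded.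
Context d (T : measurableType d) (R : realType) (nu : {charge set T -> \bar R}).

Lemma charge_integralB (f g : T -> R) :
  measurable_fun setT f -> [bounded f x | x in setT] ->
  measurable_fun setT g -> [bounded g x | x in setT] ->
  charge_integral nu (fun x => f x - g x) =
  charge_integral nu f - charge_integral nu g.
Proof.
move=> mf bf mg bg.
have int (h : T -> R) (m : {finite_measure set T -> \bar R}) : measurable_fun setT h ->
    [bounded h x | x in setT] -> m.-integrable setT (EFin \o h).
  by move=> *; apply: measurable_bounded_integrable => //;
    rewrite ltey_eq fin_num_measure.
have RB (m : {finite_measure set T -> \bar R}) :
    Rintegral m setT (fun x => f x - g x) =
    Rintegral m setT f - Rintegral m setT g.
  by apply: RintegralB => //; exact: int.
by rewrite /charge_integral !RB; ring.
Qed.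

(** Riemann estimate for the partition into a single cell, comparing f with the
    constant 0. *)
Lemma normr_charge_integral_le (f : T -> R) (M : R) :
  measurable_fun setT f -> (forall x, `|f x| <= M) ->
  `|charge_integral nu f| <= M * variation_mass nu.
Proof.
move=> mf fM.
have := @charge_integral_riemann _ _ R 1 (fun=> setT) (fun=> measurableT) _ _ nu
  f (fun=> 0) M mf.
rewrite big_ord1 mulr0 subr0; apply.
- by move=> i j _ _ _; rewrite !ord1.
- by move=> x; exists ord0.
- exists M; split=> [|N /ltW MN x _]; first exact: num_real.
  exact: le_trans MN.
- by move=> i x _; rewrite subr0.
Qed.

End charge_integral_bounded.

Section riemann_sums.
Context (R : realType) (A : pmetricType R).
Hypothesis compactA : compact [set: A].

Lemma fine_partition_sequence :
  exists _ : forall n, @tagged_partition R A n.+1%:R^-1, True.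
Proof.
have ex n : {_ : @tagged_partition R A n.+1%:R^-1 | True}.
  by apply: cid; apply: compact_tagged_partition; rewrite // invr_gt0.
by exists (fun n => sval (ex n)).
Qed.

(** The rate shared by all the approximations below, whose n-th partition has
    mesh 1 / (n + 1). *)
Lemma cvg_by_mesh (u : nat -> R) (l c : R) :
  (forall n, `|l - u n| <= n.+1%:R^-1 * c) -> u n @[n --> \oo] --> l.
Proof.
move=> lu.
have h : n.+1%:R^-1 * c @[n --> \oo] --> (0 : R).
  by rewrite -(mul0r c); apply: cvgM; [exact: cvg_harmonic|exact: cvg_cst].
apply/cvgrPdist_le => e e0.
move/cvgrPdist_le: h => /(_ e e0); apply: filterS => n; rewrite sub0r normrN => h.
exact: le_trans (lu n) (le_trans (ler_norm _) h).
Qed.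

Lemma real_cvg_unique (u : nat -> R) (l l' : R) :
  u n @[n --> \oo] --> l -> u n @[n --> \oo] --> l' -> l = l'.
Proof. exact: cvg_unique. Qed.

Section sequence.
Variable p : forall n, @tagged_partition R A n.+1%:R^-1.

Definition riemann (nu : set (borel A) -> \bar R) (f : A -> R) (n : nat) : R :=
  \sum_i fine (nu (cell (p n) i)) * f (tag (p n) i).

Variables (L : R) (f : borel A -> R).
Hypotheses (L0 : 0 <= L) (lipf : lipschitz_with L f).

Lemma cell_lipschitz n i x : cell (p n) i x ->
  `|f x - f (tag (p n) i)| <= n.+1%:R^-1 * L.
Proof.
move=> Cx; apply: le_trans (lipf _ _) _.
by rewrite mulrC ler_wpM2r//; exact: cell_small Cx.
Qed.

Lemma charge_integral_riemann_mesh (nu : signed_measure A) n :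
  `|charge_integral nu f - riemann nu f n|
    <= n.+1%:R^-1 * (L * variation_mass nu).
Proof.
rewrite mulrA; apply: charge_integral_riemann.
- exact: measurable_cell.
- exact: trivIset_cell.
- exact: cover_cell.
- exact: lipschitz_measurable lipf.
- exact: lipschitz_bounded lipf.
- exact: cell_lipschitz.
Qed.

Lemma cvg_riemann (nu : signed_measure A) :
  riemann nu f n @[n --> \oo] --> charge_integral nu f.
Proof. by apply: cvg_by_mesh => n; exact: charge_integral_riemann_mesh. Qed.

Lemma cvg_riemann_measure (m : {finite_measure set (borel A) -> \bar R}) :
  riemann m f n @[n --> \oo] --> Rintegral m setT f.
Proof.
apply: (@cvg_by_mesh _ _ (L * fine (m setT))) => n.
rewrite mulrA; apply: Rintegral_riemann.
- exact: measurable_cell.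
- exact: trivIset_cell.
- exact: cover_cell.
- apply: measurable_bounded_integrable => //.
  + by rewrite ltey_eq fin_num_measure.
  + exact: lipschitz_measurable lipf.
  + exact: lipschitz_bounded lipf.
- exact: cell_lipschitz.
Qed.

End sequence.

Section lipschitz_integrals.
Variables (L : R) (f : borel A -> R).
Hypotheses (L0 : 0 <= L) (lipf : lipschitz_with L f).

(** Identifies integrals against a signed measure that happens to be positive,
    whichever Hahn decomposition was chosen for it. *)
Lemma charge_integral_measure (m : {finite_measure set (borel A) -> \bar R})
    (nu : signed_measure A) :
  (forall E, measurable E -> nu E = m E) ->
  charge_integral nu f = Rintegral m setT f.
Proof.
move=> num; have [p _] := fine_partition_sequence.
apply: real_cvg_unique (@cvg_riemann p _ _ L0 lipf nu) _.
rewrite (_ : riemann p nu f = riemann p m f);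
  first exact: (@cvg_riemann_measure p _ _ L0 lipf m).
apply/funext => n; apply: eq_bigr => i _; rewrite num//.
exact: measurable_cell.
Qed.

(** Riemann sums are linear in the measure and depend only on its values on
    measurable sets; both properties pass to the limit. *)
Lemma charge_integral_lin (nu nu1 nu2 : signed_measure A) (a b : R) :
  (forall E, measurable E -> nu E = (a%:E * nu1 E + b%:E * nu2 E)%E) ->
  charge_integral nu f = a * charge_integral nu1 f + b * charge_integral nu2 f.
Proof.
move=> nuE; have [p _] := fine_partition_sequence.
apply: real_cvg_unique (@cvg_riemann p _ _ L0 lipf nu) _.
rewrite (_ : riemann p nu f =
             (fun n => a * riemann p nu1 f n + b * riemann p nu2 f n)).
  by apply: cvgD; apply: cvgM; (exact: cvg_cst || exact: (@cvg_riemann p _ _ L0 lipf)).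
apply/funext => n; rewrite /riemann !mulr_sumr -big_split/=.
apply: eq_bigr => i _; rewrite !mulrA -mulrDl; congr (_ * _).
have mC := measurable_cell i.
by rewrite nuE// fineD ?fin_numM ?fin_num_measure// !fineM ?fin_num_measure.
Qed.

End lipschitz_integrals.

Lemma total_mass_lin (nu nu1 nu2 : signed_measure A) (a b : R) :
  (forall E, measurable E -> nu E = (a%:E * nu1 E + b%:E * nu2 E)%E) ->
  total_mass nu = a * total_mass nu1 + b * total_mass nu2.
Proof.
move=> nuE; rewrite /total_mass nuE//.
by rewrite fineD ?fin_numM ?fin_num_measure// !fineM ?fin_num_measure.
Qed.

Lemma charge_integral1 (nu : signed_measure A) :
  charge_integral nu (fun=> 1) = total_mass nu.
Proof.
by rewrite /charge_integral !Rintegral_cst// !mul1r -fine_jordan.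
Qed.

End riemann_sums.

(** * The similarity form *)

Section similarity.
Context (R : realType) (A : pmetricType R).

Definition similarity (x y : borel A) : R := expR (- mdist (x : A) (y : A)).

Lemma similarityC x y : similarity x y = similarity y x.
Proof. by rewrite /similarity metric_sym. Qed.

(** exp(-a) - exp(-b) = exp(-a) (1 - exp(a - b)), where the first factor is at
    most 1 and the second at most b - a. *)
Lemma expRN_lipschitz (a b : R) : 0 <= a -> a <= b ->
  expR (- a) - expR (- b) <= b - a.
Proof.
move=> a0 ab; have -> : - b = - a + (a - b) by lra.
rewrite expRD -[X in X - _]mulr1 -mulrBr.
have := expR_ge1Dx (a - b) => h.
apply: (@le_trans _ _ (1 * (b - a))); last by rewrite mul1r.
apply: ler_pM; rewrite ?expR_ge0 ?subr_ge0 ?expR_le1 ?subr_le0//; first lra.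
lra.
Qed.

(** By the triangle inequality, d(x, z) is 1-Lipschitz in x. *)
Lemma similarity_lipschitz z : lipschitz_with 1 (similarity^~ z).
Proof.
move=> x y; rewrite mul1r /similarity.
wlog h : x y / mdist (x : A) (z : A) <= mdist (y : A) (z : A).
  move=> H; have [|/ltW] := leP (mdist (x : A) (z : A)) (mdist (y : A) (z : A)).
    exact: H.
  by rewrite distrC (metric_sym (x : A) (y : A)); exact: H.
rewrite ger0_norm ?subr_ge0 ?ler_expR ?lerN2//.
apply: le_trans (expRN_lipschitz (mdist_ge0 _ _) h) _.
by rewrite lerBlDr (metric_sym (x : A)) metric_triangle.
Qed.

Section compact.
Hypothesis compactA : compact [set: A].

Definition potential (mu : signed_measure A) (y : borel A) : R :=
  charge_integral mu (similarity^~ y).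

Lemma measurable_similarity y : measurable_fun setT (similarity^~ y).
Proof. exact: (lipschitz_measurable ler01 (similarity_lipschitz y)). Qed.

Lemma bounded_similarity y : [bounded similarity x y | x in setT].
Proof. exact: (lipschitz_bounded compactA ler01 (similarity_lipschitz y)). Qed.

(** Makes the outer integral of [Zform] accessible to the Riemann estimates. *)
Lemma potential_lipschitz (mu : signed_measure A) :
  lipschitz_with (variation_mass mu) (potential mu).
Proof.
move=> x y; rewrite /potential -charge_integralB; try exact: measurable_similarity;
  try exact: bounded_similarity.
rewrite mulrC; apply: normr_charge_integral_le.
  by apply: measurable_funB; exact: measurable_similarity.
move=> z; rewrite !(similarityC z).
by apply: le_trans (similarity_lipschitz z x y) _; rewrite mul1r.
Qed.

Lemma ZformE (mu nu : signed_measure A) :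
  Zform mu nu = charge_integral nu (potential mu).
Proof. by []. Qed.

Lemma Zform_lin (mu nu nu1 nu2 : signed_measure A) (a b : R) :
  (forall E, measurable E -> nu E = (a%:E * nu1 E + b%:E * nu2 E)%E) ->
  Zform mu nu = a * Zform mu nu1 + b * Zform mu nu2.
Proof.
move=> nuE; rewrite !ZformE.
exact: (charge_integral_lin compactA (variation_mass_ge0 mu)
  (@potential_lipschitz mu) nuE).
Qed.

Section approximation.
Variable p : forall n, @tagged_partition R A n.+1%:R^-1.

Definition Zsum (mu nu : signed_measure A) (n : nat) : R :=
  riemann p nu (fun y => riemann p mu (similarity^~ y) n) n.

(** The n-th error has two sources of size |mu| |nu| / (n + 1) each: freezing the
    potential of mu at the tags, and replacing it there by a Riemann sum. *)
Lemma cvg_Zsum (mu nu : signed_measure A) :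
  Zsum mu nu n @[n --> \oo] --> Zform mu nu.
Proof.
apply: (@cvg_by_mesh _ _ _ (2 * variation_mass mu * variation_mass nu)) => n.
rewrite mulrA ZformE; apply: charge_integral_riemann.
- exact: measurable_cell.
- exact: trivIset_cell.
- exact: cover_cell.
- exact: lipschitz_measurable (variation_mass_ge0 mu) (@potential_lipschitz mu).
- exact: lipschitz_bounded (variation_mass_ge0 mu) (@potential_lipschitz mu).
move=> i x Cix; set y := tag (p n) i.
apply: (@le_trans _ _ (`|potential mu x - potential mu y| +
    `|potential mu y - riemann p mu (similarity^~ y) n|)).
  by rewrite -[X in `|X|](subrKA (potential mu y)) ler_normD.
have h1 := cell_lipschitz (variation_mass_ge0 mu) (@potential_lipschitz mu) Cix.
have h2 := charge_integral_riemann_mesh compactA p ler01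
  (similarity_lipschitz y) mu n.
rewrite mul1r in h2.
by rewrite mulrCA mulr_natl mulr2n lerD.
Qed.

Lemma ZsumC (mu nu : signed_measure A) n : Zsum mu nu n = Zsum nu mu n.
Proof.
rewrite /Zsum /riemann; under eq_bigr do rewrite mulr_sumr.
rewrite exchange_big/=; apply: eq_bigr => i _; rewrite mulr_sumr.
by apply: eq_bigr => j _; rewrite similarityC mulrCA.
Qed.

(** The sum is v^T S v for S the similarity matrix of the tags and v the vector
    of masses of the cells. *)
Lemma Zsum_ge0 (mu : signed_measure A) n : positive_definite A -> 0 <= Zsum mu mu n.
Proof.
move=> pdA; pose B := tags (p n).
have B0 : B != fset0.
  have [i _] := cover_cell (p n) point; apply/eqP => B0.
  by have := fsvalP (enum_val i); move: (fsval _) => z; rewrite -/B B0 inE.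
have [_ pd] := pdA B B0.
pose v : 'cV[R]_#|{: B}| := \col_i fine (mu (cell (p n) i)).
have -> : Zsum mu mu n = (v^T *m similarity_matrix B *m v) 0 0.
  rewrite !mxE; apply: eq_bigr => j _; rewrite !mxE mulrC; congr (_ * _).
  by apply: eq_bigr => i _; rewrite !mxE.
by have [->|/pd/ltW//] := eqVneq v 0; rewrite mulmx0 mxE.
Qed.

End approximation.

Lemma ZformC (mu nu : signed_measure A) : Zform mu nu = Zform nu mu.
Proof.
have [p _] := fine_partition_sequence compactA.
apply: (real_cvg_unique (@cvg_Zsum p mu nu)).
rewrite (_ : Zsum p mu nu = Zsum p nu mu); first exact: cvg_Zsum.
by apply/funext => n; exact: ZsumC.
Qed.

Lemma Zform_ge0 (mu : signed_measure A) : positive_definite A -> 0 <= Zform mu mu.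
Proof.
move=> pdA; have [p _] := fine_partition_sequence compactA.
have h := @cvg_Zsum p mu mu.
rewrite -(cvg_lim (@Rhausdorff R) h); apply: limr_ge.
  by apply/cvg_ex; eexists; exact: h.
by near=> n; exact: Zsum_ge0.
Unshelve. all: by end_near. Qed.

Definition point_mass (x : A) : signed_measure A :=
  charge_of_finite_measure (dirac (x : borel A)).

Lemma total_mass_point x : total_mass (point_mass x) = 1.
Proof. by rewrite /total_mass [X in fine X](diracT R (x : borel A)). Qed.

Lemma Zform_point (mu : signed_measure A) x : Zform mu (point_mass x) = potential mu x.
Proof.
have lp := @potential_lipschitz mu.
rewrite ZformE (charge_integral_measure compactA (variation_mass_ge0 mu) lp
  (m := dirac (x : borel A)))//.
rewrite /Rintegral integral_dirac//; first by rewrite diracT mul1e.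
apply/measurable_EFinP.
exact: lipschitz_measurable (variation_mass_ge0 mu) lp.
Qed.

Lemma potential_point x y : potential (point_mass x) y = similarity x y.
Proof.
rewrite /potential (charge_integral_measure compactA ler01
  (similarity_lipschitz y) (m := dirac (x : borel A)))//.
rewrite /Rintegral integral_dirac//; first by rewrite diracT mul1e.
by apply/measurable_EFinP; exact: measurable_similarity.
Qed.

Lemma weight_measureP (w : signed_measure A) :
  weight_measure w <-> forall x, potential w x = 1.
Proof.
have E x : potential w x = charge_integral w (similarity x).
  by congr charge_integral; apply/funext => y; rewrite similarityC.
by split=> h x; [rewrite E|rewrite -[LHS]E]; exact: h.
Qed.

(** The outer integral is that of the potential of w, which is constantly 1. *)
Lemma Zform_weight (w nu : signed_measure A) :
  weight_measure w -> Zform w nu = total_mass nu.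
Proof.
move=> /weight_measureP h; rewrite ZformE -charge_integral1.
by congr charge_integral; apply/funext.
Qed.

End compact.
End similarity.

(** * Cauchy-Schwarz, weights and maximisers *)

Section cauchy_schwarz.
Context (R : realType) (A : pmetricType R).
Hypotheses (compactA : compact [set: A]) (pdA : positive_definite A).

Definition perturbed (mu nu : signed_measure A) (t : R) : signed_measure A :=
  cadd mu (cscale t nu).

Lemma perturbedE mu nu t E : perturbed mu nu t E = (1%:E * mu E + t%:E * nu E)%E.
Proof. by rewrite mul1e. Qed.

Lemma total_mass_perturbed mu nu t :
  total_mass (perturbed mu nu t) = total_mass mu + t * total_mass nu.
Proof.
rewrite (total_mass_lin (a := 1) (nu1 := mu) (b := t) (nu2 := nu)) ?mul1r// => E _.
exact: perturbedE.
Qed.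

Lemma Zform_perturbed mu nu t :
  Zform (perturbed mu nu t) (perturbed mu nu t) =
  Zform mu mu + 2 * t * Zform mu nu + t ^+ 2 * Zform nu nu.
Proof.
have H la : Zform la (perturbed mu nu t) = 1 * Zform la mu + t * Zform la nu.
  by apply: Zform_lin => // E _; exact: perturbedE.
have Zp la : Zform (perturbed mu nu t) la = Zform la mu + t * Zform la nu.
  by rewrite ZformC// H mul1r.
rewrite H (Zp mu) (Zp nu) (ZformC compactA nu mu).
by move: (Zform mu mu) (Zform mu nu) (Zform nu nu) => a b c; ring.
Qed.

Lemma Zform_scale (mu w : signed_measure A) c :
  (forall E, measurable E -> mu E = cscale c w E) ->
  Zform mu mu = c ^+ 2 * Zform w w /\ total_mass mu = c * total_mass w.
Proof.
move=> muE.
have muE' E : measurable E -> mu E = (c%:E * w E + 0%:E * w E)%E.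
  by move=> mE; rewrite muE// mul0e adde0.
have H la : Zform la mu = c * Zform la w.
  by rewrite (Zform_lin compactA la muE') mul0r addr0.
split; first by rewrite H ZformC// H mulrA expr2.
by rewrite (total_mass_lin muE') mul0r addr0.
Qed.

Lemma nonneg_quadratic_discriminant (a b c : R) :
  (forall t, 0 <= a + 2 * t * b + t ^+ 2 * c) -> b ^+ 2 <= a * c.
Proof.
move=> h; pose q : {poly R} := Poly [:: a; 2 * b; c].
suff : q`_1 ^+ 2 - 4 * q`_2 * q`_0 <= 0 by rewrite !coef_Poly/=; lra.
rewrite deg_le2_poly_ge0 ?size_Poly// => t; rewrite horner_Poly/= mul0r add0r.
by apply: le_trans (h t) _; rewrite le_eqVlt; apply/orP; left; apply/eqP; ring.
Qed.

Lemma Zform_cauchy_schwarz (mu nu : signed_measure A) :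
  Zform mu nu ^+ 2 <= Zform mu mu * Zform nu nu.
Proof.
apply: nonneg_quadratic_discriminant => t.
by rewrite -Zform_perturbed; exact: Zform_ge0.
Qed.

(** If Z(w, w) = w(A) vanished, Cauchy-Schwarz against a point mass would give
    1 = Z(w, delta)^2 <= 0. *)
Lemma Zform_weight_gt0 (w : signed_measure A) :
  weight_measure w -> 0 < total_mass w.
Proof.
move=> hw; have ww := Zform_weight w hw; rewrite -ww lt0r Zform_ge0// andbT.
apply/eqP => w0.
have := Zform_cauchy_schwarz w (point_mass (point : A)).
by rewrite w0 mul0r Zform_weight// total_mass_point expr1n ler10.
Qed.

Lemma magnitude_weight (w : signed_measure A) :
  weight_measure w -> magnitude A = (total_mass w)%:E.
Proof.
move=> hw; have w0 := Zform_weight_gt0 hw.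
apply/eqP; rewrite eq_le; apply/andP; split.
  apply: ge_ereal_sup => _ [nu /= nu0 <-]; rewrite lee_fin.
  have nu1 : 0 < Zform nu nu by rewrite lt0r nu0 Zform_ge0.
  rewrite ler_pdivrMr// -(Zform_weight w hw) -[X in X ^+ 2](Zform_weight nu hw).
  exact: Zform_cauchy_schwarz.
apply: ereal_sup_ubound; exists w => /=; first by rewrite Zform_weight// gt_eqF.
by rewrite Zform_weight// expr2 mulfK// gt_eqF.
Qed.

Lemma scaled_weight_achieves (mu w : signed_measure A) c :
  c != 0 -> weight_measure w ->
  (forall E, measurable E -> mu E = cscale c w E) -> achieves_magnitude mu.
Proof.
move=> c0 hw muE; have [Zmu mmu] := Zform_scale muE.
have w0 : total_mass w != 0 by rewrite gt_eqF// Zform_weight_gt0.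
rewrite /achieves_magnitude (magnitude_weight hw) Zmu mmu Zform_weight//.
split; first by rewrite mulf_neq0// expf_neq0.
by congr EFin; field; rewrite c0 w0.
Qed.

(** Point masses have total mass 1 and energy exp(0) = 1. *)
Lemma magnitude_ge1 : (1%:E <= magnitude A)%E.
Proof.
apply: ereal_sup_ubound; exists (point_mass (point : A)) => /=;
  rewrite ?total_mass_point Zform_point// potential_point// /similarity;
  rewrite mdistxx oppr0 expR0.
  exact: oner_neq0.
by rewrite expr1n divr1.
Qed.

(** With Z(t) = a + 2 t b + t^2 and m(t) = m + t, the function r Z - m^2 vanishes
    at 0 and has derivative 2 (r b - m) there.  If c = r b - m were nonzero,
    moving slightly in the direction - c would make the function negative. *)
Lemma first_variation (a b r m : R) : 0 < a -> 1 <= r -> m ^+ 2 = r * a ->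
  (forall t, 0 < a + 2 * t * b + t ^+ 2 ->
     (m + t) ^+ 2 <= r * (a + 2 * t * b + t ^+ 2)) -> r * b = m.
Proof.
move=> a0 r1 ma h; apply/eqP; rewrite -subr_eq0; apply/negPn/negP => c0.
set c := r * b - m in c0.
(* s is small enough both for Z(- s c) > 0 and for s r <= 1 *)
pose s := a / (a * r + 2 * `|c * b| + 1).
have D0 : 0 < a * r + 2 * `|c * b| + 1.
  by rewrite ltr_wpDl// addr_ge0 ?mulr_ge0// ltW// (lt_le_trans _ r1).
have s0 : 0 < s by exact: divr_gt0.
have sD : s * (a * r + 2 * `|c * b| + 1) = a by rewrite divfK ?gt_eqF.
have cb := ler_norm (c * b).
have scb : 0 <= s * (`|c * b| - c * b) by rewrite mulr_ge0 ?subr_ge0// ltW.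
have sar : 0 < s * (a * r) by rewrite mulr_gt0// mulr_gt0// (lt_le_trans _ r1).
have c2 : 0 < c ^+ 2 by rewrite exprn_even_gt0.
have := h (- s * c).
have -> : (m + - s * c) ^+ 2 =
  r * (a + 2 * (- s * c) * b + (- s * c) ^+ 2) +
    s * c ^+ 2 * (2 - s * (r - 1)).
  have -> : (m + - s * c) ^+ 2 = m ^+ 2 - 2 * m * s * c + s ^+ 2 * c ^+ 2 by ring.
  by rewrite ma /c; ring.
rewrite gerDl => {}h.
have : s * c ^+ 2 * (2 - s * (r - 1)) <= 0.
  by apply: h; have : 0 <= (s * c) ^+ 2 by [apply: sqr_ge0]; lra.
rewrite leNgt => /negP; apply.
apply: mulr_gt0; first exact: mulr_gt0.
rewrite subr_gt0.
have : s * r <= 1.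
  rewrite -(ler_pM2r a0) mul1r -[leRHS]sD.
  have : 0 <= s * `|c * b| by rewrite mulr_ge0// ltW.
  lra.
lra.
Qed.

(** Maximality along the lines mu + t delta_x makes the potential of mu constant,
    equal to mu(A) / |A|. *)
Lemma achieves_scaled_weight (mu : signed_measure A) : achieves_magnitude mu ->
  exists (c : R) (w : signed_measure A),
    [/\ c != 0, weight_measure w &
      forall E : set (borel A), measurable E -> mu E = cscale c w E].
Proof.
move=> [Z0]; set r := _ / _ => magr; set m := total_mass mu in r magr.
have Zgt0 : 0 < Zform mu mu by rewrite lt0r Z0 Zform_ge0.
have r1 : 1 <= r by rewrite -lee_fin magr magnitude_ge1.
have r0 : r != 0 by rewrite gt_eqF// (lt_le_trans _ r1).
have mE : m ^+ 2 = r * Zform mu mu by rewrite divfK.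
have m0 : m != 0 by rewrite -sqrf_eq0 mE mulf_neq0.
have pot x : r * potential mu x = m.
  apply: first_variation Zgt0 r1 mE _ => t.
  have -> : Zform mu mu + 2 * t * potential mu x + t ^+ 2 =
      Zform (perturbed mu (point_mass x) t) (perturbed mu (point_mass x) t).
    rewrite Zform_perturbed !Zform_point// potential_point// /similarity.
    by rewrite mdistxx oppr0 expR0 mulr1.
  have -> : m + t = total_mass (perturbed mu (point_mass x) t).
    by rewrite total_mass_perturbed total_mass_point mulr1.
  move=> Zt; rewrite -ler_pdivrMr// -lee_fin magr.
  by apply: ereal_sup_ubound; exists (perturbed mu (point_mass x) t) => //=;
    rewrite gt_eqF.
pose w : signed_measure A := cscale (r / m) mu.
exists (m / r), w; split; first by rewrite mulf_neq0 ?invr_eq0.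
  apply/weight_measureP => x.
  have wE E : measurable E -> w E = ((r / m)%:E * mu E + 0%:E * mu E)%E.
    by rewrite mul0e adde0.
  rewrite -Zform_point// ZformC// (Zform_lin compactA _ wE) ZformC// Zform_point//.
  by rewrite mul0r addr0 mulrAC pot divff.
move=> E _; rewrite /cscale/= /cscale muleA -EFinM.
by rewrite (_ : m / r * (r / m) = 1) ?mul1e//; field; rewrite m0 r0.
Qed.

End cauchy_schwarz.

Theorem theorem2p3 (R : realType) (A : pmetricType R)
    (compactA : compact [set: A]) (pdA : positive_definite A) :
  (forall mu : signed_measure A,
     achieves_magnitude mu <->
     exists (c : R) (w : signed_measure A),
       [/\ c != 0, weight_measure w &
           forall E : set (borel A), measurable E -> mu E = cscale c w E]) /\
  (forall mu : signed_measure A,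
     weight_measure mu -> magnitude A = (total_mass mu)%:E).
Proof.
split=> [mu|mu]; last exact: magnitude_weight.
split=> [|[c [w [c0 hw muE]]]]; first exact: achieves_scaled_weight.
exact: scaled_weight_achieves muE.
Qed.
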